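(* For every $\mu\in\mathbb R^m$, the set $\{\mu_D\in\mathbb R^{N-m} : (\mu,\mu_D)\in\tilde{\mathcal R}^{(\mathrm{cur})}_{\epsilon,p}\}$ is convex; that is, the current-based capacity region $\tilde{\mathcal R}^{(\mathrm{cur})}_{\epsilon,p}$ is convex in the vector $\mu_D$ of deterministic power injections.
   Context: Network. $\mathcal G=(\mathcal N,\mathcal L)$ is a finite connected graph with nodes $\{0,1,\dots,N\}$, arbitrarily oriented edges (lines) $\ell\in\mathcal L$ and weights $w_\ell>0$. $A\in\mathbb R^{|\mathcal L|\times(N+1)}$ is the incidence matrix ($A_{\ell,i}=1$ if $\ell=(i,j)$, $-1$ if $\ell=(j,i)$, $0$ otherwise), $W=\mathrm{diag}(w_\ell)$, $B=A^\top WA$, $\hat B$ is $B$ with the row and column of node $0$ deleted, $\breve B=\begin{pmatrix}0&0\\0&\hat B^{-1}\end{pmatrix}$, $\Lambda=\mathrm{diag}(1/I_{\ell,\max})$ with constants $I_{\ell,\max}>0$, and $\overline C=\Lambda WA\breve B$. Fix $1\le m\le N$; $C$ consists of columns $1,\dots,m$ of $\overline C$ and $C_D$ of columns $m+1,\dots,N$. For $\overline\mu=(\mu,\mu_D)\in\mathbb R^m\times\mathbb R^{N-m}=\mathbb R^N$ put $y=C_D\mu_D$. Rate function. $T>0$. For each $\mu\in\mathbb R^m$ (the functions may depend on $\mu$, not on $\mu_D$) there are given, for $i=1,\dots,m$, a drift $b_i:\mathbb R\to\mathbb R$, Lipschitz and differentiable with $b_i(\mu_i)=0$, and a diffusion coefficient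 $l_i:\mathbb R\to(0,\infty)$, Lipschitz, bounded and differentiable. $H^1_\mu$ is the set of $g:[0,T]\to\mathbb R^m$ with $g(t)=\mu+\int_0^t\phi(s)\,ds$, $\phi\in L_2([0,T])$. For $g\in H^1_\mu$, $\mathcal I_{\mathrm{pow}}(g)=\sum_{i=1}^m\frac12\int_0^T\left(\frac{g_i'-b_i(g_i)}{l_i(g_i)}\right)^2dt$. For continuous $f:[0,T]\to\mathbb R^{|\mathcal L|}$, $\|f\|_\infty=\max_{t\in[0,T]}\max_\ell|f_\ell(t)|$. Decay rate and region. $\mathcal I_{\mathrm{cur}}^*(\overline\mu)=\inf\{\mathcal I_{\mathrm{pow}}(g): g\in H^1_\mu,\ \|y+Cg\|_\infty\ge1\}$ (infimum over the empty set is $+\infty$). For $\epsilon>0$ and $p\in(0,1)$, $\tilde{\mathcal R}^{(\mathrm{cur})}_{\epsilon,p}=\{\overline\mu\in\mathbb R^N:\mathcal I_{\mathrm{cur}}^*(\overline\mu)\ge-\epsilon\log p\}$. *)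

(* Defs.v *)
From HB Require Import structures.
From mathcomp Require Import all_boot all_order all_algebra.
From mathcomp Require Import all_classical all_reals all_analysis.

Set Implicit Arguments.
Unset Strict Implicit.
Unset Printing Implicit Defensive.

Import Order.TTheory GRing.Theory Num.Theory.
Import numFieldNormedType.Exports.

Local Open Scope classical_set_scope.
Local Open Scope ring_scope.

(* A line is an oriented pair of nodes.  The field [lines_oriented] says that
   each edge carries a single orientation; its case i = j rules out loops. *)
Record network (R : realType) (N : nat) := Network {
  lines : {set 'I_N.+1 * 'I_N.+1};
  lines_oriented : forall i j, (i, j) \in lines -> (j, i) \notin lines;
  lines_connected : forall i j,
    connect [rel u v | ((u, v) \in lines) || ((v, u) \in lines)] i j;
  weight : 'I_#|lines| -> R;
  weight_gt0 : forall e, 0 < weight e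
}.

Definition incidence (R : realType) (N : nat) (G : network R N) :
    'M[R]_(#|lines G|, N.+1) :=
  \matrix_(e, i) (if i == (enum_val e).1 then 1
                  else if i == (enum_val e).2 then -1 else 0).

Definition weight_mx (R : realType) (N : nat) (G : network R N) :
    'M[R]_#|lines G| :=
  diag_mx (\row_e weight e).

Definition laplacian (R : realType) (N : nat) (G : network R N) :
    'M[R]_N.+1 :=
  (incidence G)^T *m weight_mx G *m incidence G.

Definition reduced_laplacian (R : realType) (N : nat) (G : network R N) :
    'M[R]_N :=
  row' ord0 (col' ord0 (laplacian G)).

(* [invmx] is a genuine inverse here: the reduced Laplacian of a connected
   graph with positive weights is positive definite. *)
Definition breve_laplacian (R : realType) (N : nat) (G : network R N) :
    'M[R]_(1 + N) :=
  block_mx 0 0 0 (invmx (reduced_laplacian G)).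

Definition Cbar (R : realType) (N : nat) (G : network R N)
    (Imax : 'I_#|lines G| -> R) : 'M[R]_(#|lines G|, 1 + N) :=
  diag_mx (\row_e (1 / Imax e)) *m weight_mx G *m incidence G
    *m breve_laplacian G.

(* The columns of [Cbar] are indexed by the nodes 0, ..., m + n: column 0 is
   dropped, [Cstoch] keeps columns 1, ..., m, [Cdet] columns m+1, ..., m+n. *)
Definition Cstoch (R : realType) (m n : nat) (G : network R (m + n))
    (Imax : 'I_#|lines G| -> R) : 'M[R]_(#|lines G|, m) :=
  lsubmx (rsubmx (Cbar Imax)).

Definition Cdet (R : realType) (m n : nat) (G : network R (m + n))
    (Imax : 'I_#|lines G| -> R) : 'M[R]_(#|lines G|, n) :=
  rsubmx (rsubmx (Cbar Imax)).

(* Paths on [0, T] are represented by functions on the real line; the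
   definitions below depend on their values on [0, T] only. *)
Definition H1 (R : realType) (m : nat) (T : R) (mu : 'cV[R]_m) :
    set (R -> 'cV[R]_m) :=
  [set g : R -> 'cV[R]_m | exists phi : R -> 'cV[R]_m,
    [/\ forall i, measurable_fun `[0, T] (fun s => phi s i ord0),
        forall i, (@lebesgue_measure R).-integrable `[0, T]
          (fun s => (phi s i ord0 ^+ 2)%:E) &
        forall t, t \in `[0, T] -> forall i,
          g t i ord0 = mu i ord0 +
            \int[@lebesgue_measure R]_(s in `[0, t]) phi s i ord0]].

(* The derivative exists almost everywhere on [0, T] when g belongs to
   [H1 T mu]; the value of [derive1] on the remaining null set, endpoints
   included, does not affect the integral. *)
Definition Ipow (R : realType) (m : nat) (T : R) (b l : 'I_m -> R -> R)
    (g : R -> 'cV[R]_m) : \bar R :=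
  (\sum_(i < m) (2^-1)%:E *
    \int[@lebesgue_measure R]_(t in `[0%R, T])
      (((derive1 (fun s => g s i ord0) t - b i (g t i ord0))
         / l i (g t i ord0)) ^+ 2)%:E)%E.

(* The norm `| f t | of a column vector is the maximum of the absolute values
   of its entries.  The supremum over t is a maximum when f is continuous. *)
Definition sup_norm (R : realType) (k : nat) (T : R) (f : R -> 'cV[R]_k) :
    \bar R :=
  ereal_sup [set (`|f t|)%:E | t in `[0, T]].

Definition Icur (R : realType) (m n : nat) (G : network R (m + n))
    (Imax : 'I_#|lines G| -> R) (T : R)
    (b l : 'cV[R]_m -> 'I_m -> R -> R) (mubar : 'cV[R]_(m + n)) : \bar R :=
  let mu := usubmx mubar in
  let y := Cdet Imax *m dsubmx mubar in
  ereal_inf [set Ipow T (b mu) (l mu) g | g in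
    [set g : R -> 'cV[R]_m | H1 T mu g /\
             (1 <= sup_norm T (fun t => y + Cstoch Imax *m g t)%R)%E]].

Definition current_region (R : realType) (m n : nat) (G : network R (m + n))
    (Imax : 'I_#|lines G| -> R) (T : R)
    (b l : 'cV[R]_m -> 'I_m -> R -> R) (eps p : R) : set 'cV[R]_(m + n) :=
  [set mubar | ((- eps * ln p)%:E <= Icur Imax T b l mubar)%E].

(* Main.v *)
Require Import Defs.
From HB Require Import structures.
From mathcomp Require Import all_boot all_order all_algebra.
From mathcomp Require Import all_classical all_reals all_analysis.

Set Implicit Arguments.
Unset Strict Implicit.
Unset Printing Implicit Defensive.

Import Order.TTheory GRing.Theory Num.Theory.
Import numFieldNormedType.Exports.

Local Open Scope classical_set_scope.
Local Open Scope ring_scope.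

(** An infimum is at least [c] when no competitor has cost below [c].  So for
    fixed [mu] the region is the intersection, over the paths [g] with
    [Ipow g < c], of the sublevel sets [|| y + C g ||_oo < 1] of a quasiconvex
    function of [mu_D]; the set of these paths does not depend on [mu_D]. *)

(** At each [t] the triangle inequality bounds the norm by a weighted mean of [|u t|] and [|v t|],
    hence by the larger one. *)
Lemma sup_norm_quasiconvex (R : realType) (k : nat) (T : R)
    (u v : R -> 'cV[R]_k) (a : {i01 R}) :
  (sup_norm T (fun t => a%:num *: u t + (1 - a%:num) *: v t)%R
   <= maxe (sup_norm T u) (sup_norm T v))%E.
Proof.
apply: ge_ereal_sup => _ [t tT <-].
(* Comparing at a fixed [t] keeps the arithmetic in [R]: the suprema may be [+oo]. *)
apply: (@le_trans _ _ (maxe `|u t|%:E `|v t|%:E)); last first.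
  rewrite ge_max !le_max; apply/andP; split; apply/orP; [left|right];
    by apply: ereal_sup_ubound; exists t.
rewrite -EFin_max lee_fin (le_trans (ler_normD _ _))// !normrZ.
have a0 : 0 <= a%:num :> R by [].
have a1 : 0 <= (1 - a%:num) :> R by rewrite subr_ge0.
rewrite !ger0_norm//.
(* The maximum is split with weights [a] and [1 - a], to compare term by term. *)
rewrite -[leRHS]mul1r -[X in X * Num.max _ _](subrKC a%:num) [leRHS]mulrDl.
by rewrite lerD// ler_wpM2l// le_max lexx ?orbT.
Qed.

(** Contrapositive of the lower bound on every competitor; if there is none, the infimum is [+oo]
    and the right side holds too. *)
Lemma current_regionP (R : realType) (m n : nat) (G : network R (m + n))
    (Imax : 'I_#|lines G| -> R) (T : R) (b l : 'cV[R]_m -> 'I_m -> R -> R)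
    (eps p : R) (mu : 'cV[R]_m) (muD : 'cV[R]_n) :
  current_region Imax T b l eps p (col_mx mu muD) <->
  forall g, H1 T mu g -> (Ipow T (b mu) (l mu) g < (- eps * ln p)%:E)%E ->
    (sup_norm T (fun t => Cdet Imax *m muD + Cstoch Imax *m g t)%R < 1)%E.
Proof.
rewrite /current_region /Icur /= col_mxKu col_mxKd; split.
- move=> /ereal_infP le_Ipow g Hg; rewrite !ltNge; apply: contra => g1.
  by apply: le_Ipow; exists g.
- move=> lt1; apply/ereal_infP => _ [g [Hg g1] <-].
  by rewrite leNgt; apply/negP => /(lt1 _ Hg); rewrite ltNge g1.
Qed.

Theorem mainTheorem2 (R : realType) (m n : nat) (m_gt0 : (0 < m)%N)
  (G : network R (m + n))
  (Imax : 'I_#|lines G| -> R) (Imax_gt0 : forall e, 0 < Imax e)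
  (T : R) (T_gt0 : 0 < T)
  (b l : 'cV[R]_m -> 'I_m -> R -> R)
  (b_lipschitz : forall mu i, lipschitz (b mu i))
  (b_derivable : forall mu i x, derivable (b mu i) x 1)
  (b_mu : forall mu i, b mu i (mu i ord0) = 0)
  (l_gt0 : forall mu i x, 0 < l mu i x)
  (l_lipschitz : forall mu i, lipschitz (l mu i))
  (l_bounded : forall mu i, bounded_fun (l mu i))
  (l_derivable : forall mu i x, derivable (l mu i) x 1)
  (eps p : R) (eps_gt0 : 0 < eps) (p_gt0 : 0 < p) (p_lt1 : p < 1)
  (mu : 'cV[R]_m) :
  convex_set [set muD : convex_lmodType 'cV[R]_n |
    current_region Imax T b l eps p (col_mx mu muD)].
Proof.
move=> x y a /set_mem /current_regionP xR /set_mem /current_regionP yR.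
apply/mem_set/current_regionP => g Hg Ig.
(* The map from [muD] to the current is affine: since the weights sum to 1, the common term in [g]
   can be shared between the two summands. *)
have -> : (fun t => Cdet Imax *m (conv a x y : 'cV[R]_n) + Cstoch Imax *m g t)
    = (fun t => a%:num *: (Cdet Imax *m x + Cstoch Imax *m g t)
        + (1 - a%:num) *: (Cdet Imax *m y + Cstoch Imax *m g t)).
  apply/funext => t; rewrite !scalerDr addrACA -scalerDl addrCA subrr addr0.
  by rewrite scale1r !scalemxAr -mulmxDr addrC.
(* The same [g] is tested at [x] and at [y]; a maximum of two values below 1 stays strictly below
   1. *)
apply: le_lt_trans (sup_norm_quasiconvex _ _ _ _) _.
by rewrite gt_max xR ?yR.
Qed.
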